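(* Consider the linearized 3D SLAM system with $m$ observed landmarks, of which the landmarks $1,\dots,s$ have known position and the remaining $n=m-s\ge 0$ have unknown position. Assume the system is piecewise constant over $N\ge1$ consecutive time segments of durations $t_{\Delta_1},\dots,t_{\Delta_N}>0$, with constant system matrix $\bm F_j$ and constant observation matrix $\bm H_j$ (as given in the context) on segment $j$, $j=1,\dots,N$. If at least three known landmarks which are not placed on a straight line are observed (i.e. $s\ge 3$ and some three of the known positions $\bm\rho_1,\dots,\bm\rho_s\in\mathbb{R}^3$ are not collinear), then the system is completely observable over the union of the $N$ segments, i.e. the total observability matrix $$\tilde{\mathcal{O}}=\begin{bmatrix}\mathcal{O}_1\\ \mathcal{O}_2\,e^{\bm F_1t_{\Delta_1}}\\ \vdots\\ \mathcal{O}_N\,e^{\bm F_{N-1}t_{\Delta_{N-1}}}\cdots e^{\bm F_1t_{\Delta_1}}\end{bmatrix},\qquad \mathcal{O}_j=\begin{bmatrix}\bm H_j^T & (\bm H_j\bm F_j)^T & \cdots & (\bm H_j\bm F_j^{3n+14})^T\end{bmatrix}^T,$$ has full rank $3n+15$.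
   Context: For $\bm u\in\mathbb{R}^3$, $[\bm u\times]$ is the $3\times3$ skew-symmetric matrix with $[\bm u\times]\bm w=\bm u\times\bm w$ for all $\bm w\in\mathbb{R}^3$. $\bm 1_3$ and $\bm 0_3$ are the $3\times 3$ identity and zero matrices, and $\bm 0_{a\times b}$ is the $a\times b$ zero matrix. The (error) state is partitioned into blocks of size 3, in this order: attitude error, vehicle position, vehicle velocity, gyro bias, accelerometer bias, then the positions of the $n$ unknown landmarks $s+1,\dots,m$. Its dimension is $15+3n$. On segment $j$ the following data are constant: the nominal rotation matrix $\bar{\bm A}_j\in SO(3)$, the nominal angular velocity $\bar{\bm\omega}_j\in\mathbb{R}^3$, the nominal acceleration $\bar{\bm a}_j\in\mathbb{R}^3$, the estimated vehicle position $\hat{\bm r}_j\in\mathbb{R}^3$, and the (estimated) landmark positions $\hat{\bm\rho}_{i,j}\in\mathbb{R}^3$, $i=1,\dots,m$, in the inertial frame, where $\hat{\bm\rho}_{i,j}=\bm\rho_i$ for the known landmarks $i\le s$. These data are arbitrary and may differ from segment to segment. The vehicle-frame landmark positions are $\hat{\bm p}_{i,j}=\bar{\bm A}_j^T(\hat{\bm\rho}_{i,j}-\hat{\bm r}_j)$. The system matrix on segment $j$ is (the last block column has width $3n$) $$\bm F_j=\begin{bmatrix} -[\bar{\bm\omega}_j\times] & \bm 0_3 & \bm 0_3 & \tfrac12\bm 1_3 & \bm 0_3 & \bm 0_{3\times 3n}\\ \bm 0_3 & \bm 0_3 & \bm 1_3 & \bm 0_3 & \bm 0_3 & \bm 0_{3\times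 3n}\\ -2\bar{\bm A}_j[\bar{\bm a}_j\times] & \bm 0_3 & \bm 0_3 & \bm 0_3 & \bar{\bm A}_j & \bm 0_{3\times 3n}\\ & & \bm 0_{(6+3n)\times(15+3n)} & & & \end{bmatrix}.$$ The observation matrix $\bm H_j\in\mathbb{R}^{3m\times(15+3n)}$ consists of $m$ block rows of height 3. For $i=1,\dots,s$ the $i$-th block row is $$\begin{bmatrix}2[\hat{\bm p}_{i,j}\times] & -\bar{\bm A}_j^T & \bm 0_3 & \bm 0_3 & \bm 0_3 & \bm 0_{3\times 3n}\end{bmatrix}.$$ For $i=s+1,\dots,m$ the $i$-th block row is $$\begin{bmatrix}2[\hat{\bm p}_{i,j}\times] & -\bar{\bm A}_j^T & \bm 0_3 & \bm 0_3 & \bm 0_3 & \bm 0_3\;\cdots\;\bar{\bm A}_j^T\;\cdots\;\bm 0_3\end{bmatrix},$$ where $\bar{\bm A}_j^T$ in the last part occupies the $3\times3$ block corresponding to the position of landmark $i$ (the $(i-s)$-th of the last $n$ block columns). The piecewise constant system is called completely observable if its total observability matrix $\tilde{\mathcal{O}}$ has full rank. *)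

(* Defs.v *)
From mathcomp Require Import all_boot all_order all_algebra.
From mathcomp Require Import all_classical all_reals all_analysis.

Set Implicit Arguments.
Unset Strict Implicit.
Unset Printing Implicit Defensive.

Import Order.TTheory GRing.Theory Num.Theory.
Import numFieldNormedType.Exports.

Local Open Scope ring_scope.
Local Open Scope classical_set_scope.

(* Matrix exponential: the sum of sum_k A^k / k! in the normed space of square
   matrices. *)
Definition expmx (R : realType) (d : nat) (A : 'M[R]_d) : 'M[R]_d :=
  limn (series (fun k : nat => (k`!%:R)^-1 *: A ^+ k)).

Definition crossmul (R : realType) (u w : 'cV[R]_3) : 'cV[R]_3 :=
  let x i := u (inord i) 0 in let y i := w (inord i) 0 in
  \col_(i < 3) [:: x 1%N * y 2%N - x 2%N * y 1%N;
                   x 2%N * y 0%N - x 0%N * y 2%N;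
                   x 0%N * y 1%N - x 1%N * y 0%N]`_i.

Definition skew (R : realType) (u : 'cV[R]_3) : 'M[R]_3 :=
  let x i := u (inord i) 0 in
  \matrix_(i < 3, j < 3)
    (nth [::] [:: [::        0; - x 2%N;   x 1%N];
                  [::   x 2%N;        0; - x 0%N];
                  [:: - x 1%N;   x 0%N;        0]] i)`_j.

Lemma skewE (R : realType) (u w : 'cV[R]_3) : skew u *m w = crossmul u w.
Proof.
apply/matrixP => i j; rewrite !mxE !big_ord_recl big_ord0 !mxE (ord1 j).
have -> : ord0 = inord 0 :> 'I_3 by apply/val_inj; rewrite /= inordK.
have -> : lift (inord 0) ord0 = inord 1 :> 'I_3.
  by apply/val_inj; rewrite /= !inordK.
have -> : lift (inord 0) (lift ord0 ord0) = inord 2 :> 'I_3.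
  by apply/val_inj; rewrite /= !inordK.
rewrite !inordK //=.
by case: i => [[|[|[|i]]]] //= _;
  rewrite ?mul0r ?mulNr ?addr0 ?add0r // addrC.
Qed.

Definition SO3 (R : realType) (A : 'M[R]_3) : Prop :=
  A^T *m A = 1%:M /\ \det A = 1.

Definition collinear (R : realType) (x y z : 'cV[R]_3) : Prop :=
  exists a d : 'cV[R]_3, d != 0 /\
    forall w, w \in [:: x; y; z] -> exists c : R, w = a + c *: d.

Section PiecewiseConstant.
Variables (R : realType) (N p d : nat).
Variables (F : 'I_N -> 'M[R]_d) (H : 'I_N -> 'M[R]_(p, d)) (t : 'I_N -> R).

(* The block rows are H F^k for k = 0, ..., d - 1. *)
Definition observability (j : 'I_N) : 'M[R]_(\sum_(k < d) p, d) :=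
  \mxcol_(k < d) (H j *m F j ^+ k).

(* The factors do not commute: the list is reversed so that the last segment
   comes leftmost, as in  e^(F_(j-1) t_(j-1)) ... e^(F_0 t_0)
   (segments are numbered from 0). *)
Definition transition (j : 'I_N) : 'M[R]_d :=
  \prod_(k <- rev (enum 'I_N) | (k < j)%N) expmx (t k *: F k).

Definition total_observability :
    'M[R]_(\sum_(j < N) \sum_(k < d) p, d) :=
  \mxcol_(j < N) (observability j *m transition j).

Definition completely_observable : Prop := \rank total_observability = d.

End PiecewiseConstant.

(* Attitude error, position, velocity, gyro bias, accelerometer bias, and the
   n unknown landmarks. *)
Definition state_dim (n : nat) : nat :=
  3 + (3 + (3 + (3 + (3 + \sum_(k < n) 3)))).

Lemma state_dimE (n : nat) : state_dim n = (3 * n + 15)%N.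
Proof. by rewrite /state_dim sum_nat_const card_ord !addnA addnC mulnC. Qed.

Section SLAM.
Variables (R : realType) (s n : nat).

Definition block_row (B1 B2 B3 B4 B5 : 'M[R]_3)
    (L : 'M[R]_(3, \sum_(k < n) 3)) : 'M[R]_(3, state_dim n) :=
  row_mx B1 (row_mx B2 (row_mx B3 (row_mx B4 (row_mx B5 L)))).

Definition system_mx (A : 'M[R]_3) (omega acc : 'cV[R]_3) :
    'M[R]_(state_dim n) :=
  col_mx (block_row (- skew omega) 0 0 (2^-1)%:M 0 0)
 (col_mx (block_row 0 0 1%:M 0 0 0)
 (col_mx (block_row (- (2 *: (A *m skew acc))) 0 0 0 A 0)
         0)).

(* Landmarks are indexed by 'I_(s + n), so that m = s + n: the first s ones
   (lshift n i) are known, the last n ones (rshift s k) are unknown. *)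
Definition observation_mx (A : 'M[R]_3) (r : 'cV[R]_3)
    (rho : 'I_(s + n) -> 'cV[R]_3) :
    'M[R]_(\sum_(i < s + n) 3, state_dim n) :=
  \mxcol_(i < s + n)
    let p := A^T *m (rho i - r) in
    block_row (2 *: skew p) (- A^T) 0 0 0
      (match fintype.split i with
       | inl _ => 0
       | inr k => \mxrow_(l < n) (if l == k then A^T else 0)
       end).

End SLAM.

(* Main.v *)
Require Import Defs.
From mathcomp Require Import all_boot all_order all_algebra.
From mathcomp Require Import all_classical all_reals all_analysis.
From mathcomp Require Import ring.

Set Implicit Arguments.
Unset Strict Implicit.
Unset Printing Implicit Defensive.

Import Order.TTheory GRing.Theory Num.Theory.
Import numFieldNormedType.Exports.

Local Open Scope ring_scope.
Local Open Scope classical_set_scope.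

(** The transition matrix preceding the first segment is the identity, so
    the total observability matrix contains the observability matrix of the
    first segment, and this one already has trivial kernel. Suppose
    [H F^k x = 0] for all [k]. In [H x = 0] the differences of the rows of known
    landmarks give [(p_i - p_j) x theta = 0]; were [theta] nonzero, all known
    landmarks would lie on a line of direction [A theta]. Hence [theta = 0], and
    then the position and landmark blocks vanish. The same argument applied to
    [F x] and [F^2 x] kills the gyro bias, the velocity and the accelerometer
    bias. *)

(** The columns of [cokermx M] lie in the kernel of [M], so they vanish; the rank of the cokernel,
    [d - \rank M], is then zero. *)
Lemma rank_full_col (K : fieldType) (m d : nat) (M : 'M[K]_(m, d)) :
  (forall x : 'cV[K]_d, M *m x = 0 -> x = 0) -> \rank M = d.
Proof.
move=> kerM; have coker0 : cokermx M = 0.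
  apply/trmx_inj/row_matrixP => j; rewrite trmx0 row0 -tr_col.
  by rewrite [col j _]kerM ?trmx0 // colE mulmxA mulmx_coker mul0mx.
move: (mxrank_coker M); rewrite coker0 mxrank0 => /esym/eqP.
by rewrite subn_eq0 => dM; apply/eqP; rewrite eqn_leq rank_leq_col.
Qed.

Lemma mxcol_mul_eq0 (K : pzRingType) (m d q : nat) (p_ : 'I_m -> nat)
    (B : forall i, 'M[K]_(p_ i, d)) (x : 'M[K]_(d, q)) :
  (\mxcol_i B i) *m x = 0 -> forall i, B i *m x = 0.
Proof.
by move=> Bx0 i; rewrite -[B i](mxcolK B) submxcol_mul Bx0 submxcol0.
Qed.

Section Kernel.
Variable R : realType.

Lemma skew_mul_eq0 (u w : 'cV[R]_3) :
  Defs.skew u *m w = 0 -> w != 0 -> exists c, u = c *: w.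
Proof.
rewrite skewE => /matrixP uw0 w_neq0.
pose a : 'I_3 := inord 0; pose b : 'I_3 := inord 1; pose c : 'I_3 := inord 2.
(* Elimination principle reducing any index to the three named coordinates. *)
have E (P : 'I_3 -> Prop) : P a -> P b -> P c -> forall i, P i.
  move=> Pa Pb Pc i; rewrite -[i]inord_val.
  by case: i => [[|[|[|i]]]].
have ea : u b 0 * w c 0 = u c 0 * w b 0.
  by have /eqP := uw0 a 0; rewrite !mxE inordK //= subr_eq0 => /eqP.
have eb : u c 0 * w a 0 = u a 0 * w c 0.
  by have /eqP := uw0 b 0; rewrite !mxE inordK //= subr_eq0 => /eqP.
have ec : u a 0 * w b 0 = u b 0 * w a 0.
  by have /eqP := uw0 c 0; rewrite !mxE inordK //= subr_eq0 => /eqP.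
have [k wk] : exists k, w k 0 != 0.
  apply/existsP; apply: contraNT w_neq0; rewrite negb_exists => /forallP w0.
  by apply/eqP/matrixP => i j; rewrite (ord1 j) mxE; apply/eqP/negPn/w0.
exists (u k 0 / w k 0); apply/matrixP => i j; rewrite (ord1 j) mxE.
(* Clearing the denominator leaves [u i 0 * w k 0 = u k 0 * w i 0], which in each of the nine cases
   is trivial or one of [ea], [eb], [ec]. *)
apply: (mulIf wk); rewrite mulrAC mulfVK // {j wk}.
by elim/E: k; elim/E: i => //; rewrite ?ea ?eb ?ec // mulrC.
Qed.

Lemma noncollinear_cross_eq0 (A : 'M[R]_3) (r y1 y2 y3 theta : 'cV[R]_3) :
  A *m A^T = 1%:M -> ~ collinear y1 y2 y3 ->
  (forall y, y \in [:: y1; y2; y3] ->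
     Defs.skew (A^T *m (y - r) - A^T *m (y1 - r)) *m theta = 0) ->
  theta = 0.
Proof.
move=> AAT ncol cross0; apply/eqP/negP => /negP theta_neq0; apply: ncol.
(* The differences of vehicle-frame positions are multiples of [theta]; applying [A] turns this into
   [y - y1 = c *: (A *m theta)]. *)
exists y1, (A *m theta); split.
  apply: contraNneq theta_neq0 => A0.
  by rewrite -[theta]mul1mx -(mulmx1C AAT) -mulmxA A0 mulmx0.
move=> y /cross0 /skew_mul_eq0 /(_ theta_neq0) [c yc]; exists c.
rewrite scalemxAr -yc -mulmxBr mulmxA AAT mul1mx.
by rewrite opprB -[y - r + _]addrA addKr [RHS]addrC subrK.
Qed.

Variables (s n : nat).

Definition state (q : nat) (th r v b c : 'M[R]_(3, q))
    (l : 'M[R]_(\sum_(k < n) 3, q)) : 'M[R]_(state_dim n, q) :=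
  col_mx th (col_mx r (col_mx v (col_mx b (col_mx c l)))).

Lemma stateP (q : nat) (x : 'M[R]_(state_dim n, q)) :
  exists th r v b c l, x = state th r v b c l.
Proof.
rewrite /state_dim in x *.
exists (usubmx x), (usubmx (dsubmx x)), (usubmx (dsubmx (dsubmx x))).
exists (usubmx (dsubmx (dsubmx (dsubmx x)))).
exists (usubmx (dsubmx (dsubmx (dsubmx (dsubmx x))))).
exists (dsubmx (dsubmx (dsubmx (dsubmx (dsubmx x))))).
by rewrite /state !vsubmxK.
Qed.

Lemma block_row_state (q : nat) (B1 B2 B3 B4 B5 : 'M[R]_3) L
    (th r v b c : 'M[R]_(3, q)) l :
  block_row B1 B2 B3 B4 B5 L *m state th r v b c l =
  B1 *m th + (B2 *m r + (B3 *m v + (B4 *m b + (B5 *m c + L *m l)))).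
Proof. by rewrite /block_row /state !mul_row_col. Qed.

Lemma system_mx_state (q : nat) (A : 'M[R]_3) (omega acc : 'cV[R]_3)
    (th r v b c : 'M[R]_(3, q)) l :
  system_mx n A omega acc *m state th r v b c l =
  state (- Defs.skew omega *m th + 2^-1 *: b) v
        (- (2 *: (A *m Defs.skew acc)) *m th + A *m c) 0 0 0.
Proof.
rewrite /system_mx !mul_col_mx !block_row_state !mul0mx !mul1mx mul_scalar_mx.
by rewrite !add0r !addr0 /state !col_mx0.
Qed.

Lemma observation_mx_ker (A : 'M[R]_3) (p : 'cV[R]_3)
    (rho : 'I_(s + n) -> 'cV[R]_3) (th r v b c : 'cV[R]_3) l :
  A *m A^T = 1%:M ->
  (exists i1 i2 i3 : 'I_s, ~ collinear (rho (lshift n i1))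
     (rho (lshift n i2)) (rho (lshift n i3))) ->
  observation_mx A p rho *m state th r v b c l = 0 ->
  [/\ th = 0, r = 0 & l = 0].
Proof.
rewrite /observation_mx => AAT [i1 [i2 [i3 ncol]]] /mxcol_mul_eq0 Hx0.
(* The right-hand side does not depend on [i], so subtracting two such equations eliminates [r]. *)
have known i : 2 *: (Defs.skew (A^T *m (rho (lshift n i) - p)) *m th) = A^T *m r.
  have := Hx0 (lshift n i); rewrite block_row_state (unsplitK (inl i)) !mul0mx.
  by rewrite !addr0 mulNmx scalemxAl => /eqP; rewrite subr_eq0 => /eqP.
have skewB (u w : 'cV[R]_3) : Defs.skew (u - w) = Defs.skew u - Defs.skew w.
  apply/matrixP => -[[|[|[|i]]] //= ?] -[[|[|[|j]]] //= ?]; rewrite !mxE /=;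
  by rewrite ?mxE; ring.
have cross i : Defs.skew (A^T *m (rho (lshift n i) - p) -
    A^T *m (rho (lshift n i1) - p)) *m th = 0.
  have two_neq0 : (2 : R) != 0 by rewrite pnatr_eq0.
  apply: (scalerI two_neq0).
  by rewrite skewB mulmxBl scalerBr !known subrr scaler0.
have th0 : th = 0.
  apply: (noncollinear_cross_eq0 (r := p) AAT ncol) => y.
  by rewrite !inE => /or3P[] /eqP ->; apply: cross.
have cancelA q (z : 'M[R]_(3, q)) : A^T *m z = 0 -> z = 0.
  by move=> z0; rewrite -[z]mul1mx -AAT -mulmxA z0 mulmx0.
have r0 : r = 0.
  by apply: cancelA; rewrite -(known i1) th0 mulmx0 scaler0.
(* Once [th] and [r] vanish, the row of the unknown landmark [k] reduces to [A^T] times the [k]-th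
   block of [l]. *)
split=> //; rewrite -[l]submxcolK -mxcol0; apply/eq_mxcolP => k.
have := Hx0 (rshift s k); rewrite block_row_state (unsplitK (inr k)) th0 r0.
rewrite !mulmx0 !mul0mx !add0r -[l in _ *m l]submxcolK mul_mxrow_mxcol.
rewrite (bigD1 k) //= eqxx big1 ?addr0; first exact: cancelA.
by move=> j /negPf ->; rewrite mul0mx.
Qed.

Lemma observability_ker (A : 'M[R]_3) (omega acc p : 'cV[R]_3)
    (rho : 'I_(s + n) -> 'cV[R]_3) (x : 'cV[R]_(state_dim n)) :
  A *m A^T = 1%:M ->
  (exists i1 i2 i3 : 'I_s, ~ collinear (rho (lshift n i1))
     (rho (lshift n i2)) (rho (lshift n i3))) ->
  (forall k : 'I_(state_dim n),
    observation_mx A p rho *m system_mx n A omega acc ^+ k *m x = 0) ->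
  x = 0.
Proof.
move=> AAT ncol Ox0; set F := system_mx n A omega acc in Ox0.
have Ox k (dk : (k < state_dim n)%N) :
    observation_mx A p rho *m (F ^+ k *m x) = 0.
  by rewrite mulmxA (Ox0 (Ordinal dk)).
have [th [r [v [b [c [l xE]]]]]] := stateP x.
(* The exponents 0, 1 and 2 are admissible since [state_dim n] is at least 15, which [isT] checks by
   computation. *)
have := Ox 0 isT; rewrite expr0 mul1mx xE => /(observation_mx_ker AAT ncol).
case=> th0 r0 l0.
(* With [th = 0], the attitude and position blocks of [F x] are [2^-1 *: b] and [v]. *)
have := Ox 1 isT; rewrite expr1 xE system_mx_state th0 !mulmx0 !add0r.
case/(observation_mx_ker AAT ncol) => b0 v0 _.
(* The position block of [F^2 x] is the velocity block of [F x], now equal to [A *m c]. *)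
have := Ox 2 isT; rewrite expr2 -mulmxA xE !system_mx_state th0 b0 !mulmx0.
rewrite scaler0 !add0r => /(observation_mx_ker AAT ncol)[_ Ac0 _].
have c0 : c = 0 by rewrite -[c]mul1mx -(mulmx1C AAT) -mulmxA Ac0 mulmx0.
move/eqP: b0; rewrite scaler_eq0 invr_eq0 pnatr_eq0 /= => /eqP b0.
by rewrite r0 v0 b0 c0 l0 /state !col_mx0.
Qed.

End Kernel.

Lemma transition_ord0 (R : realType) (N d : nat) (F : 'I_N -> 'M[R]_d)
    (t : 'I_N -> R) (j : 'I_N) :
  j = 0%N :> nat -> transition F t j = 1%:M.
Proof. by move=> j0; rewrite /transition big_pred0 // => k; rewrite j0. Qed.

Theorem mainTheorem2 (R : realType) (s n N : nat)
    (t : 'I_N -> R)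
    (A : 'I_N -> 'M[R]_3)
    (omega acc r : 'I_N -> 'cV[R]_3)
    (rho : 'I_s -> 'cV[R]_3)
    (rho_hat : 'I_N -> 'I_(s + n) -> 'cV[R]_3)
    (hN : (1 <= N)%N)
    (ht : forall j, 0 < t j)
    (hA : forall j, SO3 (A j))
    (hrho : forall j i, rho_hat j (lshift n i) = rho i)
    (hs : (3 <= s)%N)
    (hnoncol : exists i1 i2 i3 : 'I_s,
        ~ collinear (rho i1) (rho i2) (rho i3)) :
  let F := fun j => system_mx n (A j) (omega j) (acc j) in
  let H := fun j => observation_mx (A j) (r j) (rho_hat j) in
  completely_observable F H t /\
  \rank (total_observability F H t) = (3 * n + 15)%N.
Proof.
move=> F H.
suff full : \rank (total_observability F H t) = state_dim n.
  by split; rewrite // full state_dimE.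
rewrite /total_observability; apply: rank_full_col => x /mxcol_mul_eq0 Ox0.
pose j0 := Ordinal hN.
have := Ox0 j0; rewrite (@transition_ord0 _ _ _ F t j0) // mulmx1.
rewrite /observability => /mxcol_mul_eq0; apply: observability_ker.
  (* [SO3] provides [A^T *m A = 1%:M]; a one-sided inverse of a square matrix is two-sided. *)
  by have [/mulmx1C] := hA j0.
by have [i1 [i2 [i3 ncol]]] := hnoncol; exists i1, i2, i3; rewrite !hrho.
Qed.
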